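(* Let $\mathfrak{B}$ be a white noise over a separable real Hilbert space $\mathbf{H}$ with orthonormal basis $\{m_k,\ k\ge1\}$. Let $\eta$ be an $\mathbf{H}$-valued random element, measurable with respect to the sigma-algebra generated by $\mathfrak{B}$, with $\mathbb{E}\|\eta\|_{\mathbf{H}}^2<\infty$ and chaos expansion $$\eta=\sum_{\alpha\in\mathcal{I}}\eta_\alpha\xi_\alpha,\qquad \eta_\alpha=\mathbb{E}(\eta\xi_\alpha)\in\mathbf{H},$$ and assume that $$\eta_\alpha=\sum_{k=1}^\infty\eta_{\alpha,k}m_k .$$ Then the Itô–Skorokhod integral of $\eta$ with respect to $\mathfrak{B}$ has the (formal) chaos expansion $$\mathfrak{B}^{\diamond}(\eta)=\sum_{\alpha\in\mathcal{I}}\left(\sum_{k=1}^\infty\sqrt{\alpha_k}\,\eta_{\alpha-\epsilon_k,k}\right)\xi_\alpha .$$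
   Context: A white noise over $\mathbf{H}$ is a family of zero-mean Gaussian random variables $\mathfrak{B}(f)$, $f\in\mathbf{H}$, linear in $f$, with $\mathbb{E}(\mathfrak{B}(f)\mathfrak{B}(g))=(f,g)_{\mathbf{H}}$. $\mathcal{I}$ is the set of multi-indices $\alpha=(\alpha_1,\alpha_2,\ldots)$ of non-negative integers with finitely many non-zero entries, $\alpha!=\prod_k\alpha_k!$, and $\epsilon_k$ is the multi-index whose only non-zero entry is $1$ at position $k$. Put $\xi_k=\mathfrak{B}(m_k)$ and $\xi_\alpha=\prod_k H_{\alpha_k}(\xi_k)/\sqrt{\alpha_k!}$, where $H_n(t)=(-1)^ne^{t^2/2}\frac{d^n}{dt^n}e^{-t^2/2}$. The $\xi_\alpha$ form an orthonormal basis of the space of square-integrable random variables measurable with respect to the sigma-algebra generated by $\mathfrak{B}$. The Wick product is $$\Big(\sum_\alpha c_\alpha\xi_\alpha\Big)\diamond\Big(\sum_\beta d_\beta\xi_\beta\Big)=\sum_{\alpha,\beta}c_\alpha d_\beta\sqrt{\frac{(\alpha+\beta)!}{\alpha!\,\beta!}}\;\xi_{\alpha+\beta}.$$ The Itô–Skorokhod stochastic integral of $\eta$ is $\mathfrak{B}^{\diamond}(\eta)=\sum_{\alpha\in\mathcal{I}}\mathfrak{B}(\eta_\alpha)\diamond\xi_\alpha$. The identity in the claim is understood at the level of formal series in $\{\xi_\alpha\}$ (collecting the coefficient of each $\xi_\alpha$), with no assertion about convergence; terms with $\alpha_k=0$ are zero, so for each $\alpha$ the inner sum has finitely many non-zero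 terms. *)

(* Defs.v *)
From HB Require Import structures.
From mathcomp Require Import all_boot all_order all_algebra finmap.
From mathcomp Require Import all_classical all_reals all_analysis.

Set Implicit Arguments.
Unset Strict Implicit.
Unset Printing Implicit Defensive.

Import Order.TTheory GRing.Theory Num.Theory.
Import numFieldNormedType.Exports.

Local Open Scope classical_set_scope.
Local Open Scope ring_scope.

(* A real Hilbert space is a complete normed module whose norm comes from an
   inner product; {dot H for idfun} is the type of positive definite symmetric
   bilinear forms on H. *)
Definition norm_of_dot (R : realType) (H : completeNormedModType R)
    (ip : {dot H for (@idfun R)}) : Prop :=
  forall u : H, `|u| ^+ 2 = ip u u.

Definition separable_space (H : topologicalType) : Prop :=
  exists2 D : set H, countable D & dense D.

(* The basis m_1, m_2, ... is indexed here from 0. *)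
Definition orthonormal_basis (R : realType) (H : completeNormedModType R)
    (ip : {dot H for (@idfun R)}) (m : nat -> H) : Prop :=
  (forall i j : nat, ip (m i) (m j) = (i == j)%:R) /\
  (forall f : H, series (fun k => ip f (m k) *: m k) @ \oo --> f).

(* The degenerate Gaussian is a separate case, because normal_prob 0 0 is by
   convention the uniform distribution on [0, 1]. *)
Definition centered_gaussian (R : realType) (d : measure_display)
    (T : measurableType d) (P : probability T R) (X : {RV P >-> R}) : Prop :=
  (exists2 s : R, s != 0 & forall A : set R, measurable A ->
     distribution P X A = normal_prob 0 s A) \/
  {ae P, forall w, X w = 0}.

Definition white_noise (R : realType) (d : measure_display)
    (T : measurableType d) (P : probability T R) (H : completeNormedModType R)
    (ip : {dot H for (@idfun R)}) (B : H -> {RV P >-> R}) : Prop :=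
  [/\ forall f : H, centered_gaussian (B f),
      forall (a : R) (f g : H),
        {ae P, forall w, B (a *: f + g) w = a * B f w + B g w} &
      forall f g : H, ('E_P[fun w => (B f w * B g w)%R] = (ip f g)%:E)%E].

Definition noise_sigma_algebra (R : realType) (d : measure_display)
    (T : measurableType d) (P : probability T R) (H : completeNormedModType R)
    (B : H -> {RV P >-> R}) : set (set T) :=
  <<s [set A : set T | exists f : H, exists2 C : set R,
         measurable C & A = B f @^-1` C] >>.

Definition noise_measurable (R : realType) (d : measure_display)
    (T : measurableType d) (P : probability T R) (H : completeNormedModType R)
    (B : H -> {RV P >-> R}) (eta : T -> H) : Prop :=
  forall U : set H, <<s [set V : set H | open V] >> U ->
    noise_sigma_algebra B (eta @^-1` U).

Definition mindex : Type := {fsfun nat -> nat with 0%N}.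
HB.instance Definition _ := Choice.on mindex.

Definition madd (a b : mindex) : mindex :=
  [fsfun k in (finsupp a `|` finsupp b)%fset => (a k + b k)%N].

(* Truncated: madd (msub a b) b = a only if b <= a componentwise. *)
Definition msub (a b : mindex) : mindex :=
  [fsfun k in finsupp a => (a k - b k)%N].

Definition munit (k : nat) : mindex := [fsfun j in [fset k]%fset => 1%N].

Definition mfact (a : mindex) : nat := (\prod_(k <- finsupp a) (a k)`!)%N.

Definition hermite (R : realType) (n : nat) (t : R) : R :=
  (-1) ^+ n * expR (t ^+ 2 / 2) * derive1n n (fun s : R => expR (- (s ^+ 2 / 2))) t.

(* The factors with a k = 0 are equal to 1. *)
Definition xi (R : realType) (d : measure_display) (T : measurableType d)
    (P : probability T R) (H : completeNormedModType R)
    (B : H -> {RV P >-> R}) (m : nat -> H) (a : mindex) (w : T) : R :=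
  \prod_(k <- finsupp a) (hermite (a k) (B (m k) w) / Num.sqrt ((a k)`!)%:R).

Definition simple_map (R : realType) (d : measure_display)
    (T : measurableType d) (H : completeNormedModType R) (s : T -> H) : Prop :=
  finite_set (range s) /\ forall v : H, measurable (s @^-1` [set v]).

Definition simple_integral (R : realType) (d : measure_display)
    (T : measurableType d) (P : probability T R) (H : completeNormedModType R)
    (s : T -> H) : H :=
  \sum_(v \in range s) fine (P (s @^-1` [set v])) *: v.

Definition is_bochner_integral (R : realType) (d : measure_display)
    (T : measurableType d) (P : probability T R) (H : completeNormedModType R)
    (X : T -> H) (v : H) : Prop :=
  exists s : nat -> T -> H,
    [/\ forall n, simple_map (s n),
        {ae P, forall w, s ^~ w @ \oo --> X w},
        ((fun n => \int[P]_w `|X w - s n w|%:E) @ \oo --> 0)%E &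
        (fun n => simple_integral P (s n)) @ \oo --> v].

(* The value is 0 when X is not Bochner integrable. *)
Definition hexpectation (R : realType) (d : measure_display)
    (T : measurableType d) (P : probability T R) (H : completeNormedModType R)
    (X : T -> H) : H :=
  xget 0 [set v : H | is_bochner_integral P X v].

Definition chaos_coef (R : realType) (d : measure_display)
    (T : measurableType d) (P : probability T R) (H : completeNormedModType R)
    (B : H -> {RV P >-> R}) (m : nat -> H) (X : T -> R) (a : mindex) : R :=
  fine ('E_P[fun w => (X w * xi B m a w)%R])%E.

Definition hchaos_coef (R : realType) (d : measure_display)
    (T : measurableType d) (P : probability T R) (H : completeNormedModType R)
    (B : H -> {RV P >-> R}) (m : nat -> H) (eta : T -> H) (a : mindex) : H :=
  hexpectation P (fun w => xi B m a w *: eta w).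

(* eta = \sum_a c a * xi_a, as an unordered sum in L^2(Omega; H). *)
Definition has_chaos_series (R : realType) (d : measure_display)
    (T : measurableType d) (P : probability T R) (H : completeNormedModType R)
    (B : H -> {RV P >-> R}) (m : nat -> H) (eta : T -> H)
    (c : mindex -> H) : Prop :=
  forall e : R, 0 < e -> exists J0 : {fset mindex}, forall J : {fset mindex},
    (J0 `<=` J)%fset ->
    (\int[P]_w (`|eta w - (\sum_(a <- J) xi B m a w *: c a)%R| ^+ 2)%:E
       < e%:E)%E.

(* The formal series \sum_a c_a xi_a is represented by its coefficients c. *)
Definition fseries (R : realType) : Type := mindex -> R.

(* A family of formal series is summable when every xi_g has a non-zero
   coefficient in only finitely many of its members. *)
Definition has_formal_sum (R : realType) (I : choiceType)
    (F : I -> fseries R) (S : fseries R) : Prop :=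
  forall g : mindex, finite_set [set i : I | F i g != 0] /\
    S g = \sum_(i \in [set: I]) F i g.

Definition wick (R : realType) (c d : fseries R) : fseries R := fun g =>
  \sum_(p \in [set p : mindex * mindex | madd p.1 p.2 = g])
    c p.1 * d p.2 *
    Num.sqrt ((mfact (madd p.1 p.2))%:R / ((mfact p.1)%:R * (mfact p.2)%:R)).

(* S is the formal series of the Ito-Skorokhod integral of eta, that is, of
   \sum_a B(eta_a) <> xi_a. *)
Definition is_ito_skorokhod (R : realType) (d : measure_display)
    (T : measurableType d) (P : probability T R) (H : completeNormedModType R)
    (B : H -> {RV P >-> R}) (m : nat -> H) (eta : T -> H)
    (S : fseries R) : Prop :=
  has_formal_sum (fun a : mindex =>
    wick (chaos_coef B m (B (hchaos_coef B m eta a)))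
         (chaos_coef B m (xi B m a))) S.

(* Main.v *)
(* Everything reduces to E[B(h) xi_b] = (h, m_k) if b = epsilon_k, and 0 if b is
   not a unit multi-index, and to the orthonormality of the xi_a; then the Wick
   product of B(eta_a) with xi_a only has the terms eta_(a,k) xi_(epsilon_k) <>
   xi_a = sqrt(a_k + 1) eta_(a,k) xi_(a + epsilon_k).

   Joint Gaussianity of the noise is not assumed: it is only known that every B(f)
   is Gaussian.  The one-dimensional recursion
   E[B(g)^(n+1)] = n |g|^2 E[B(g)^(n-1)], applied to g + t f for all t, is
   polarized into E[B(f) B(g)^n X] = n (f, g) E[B(g)^(n-1) X], first for X = 1
   and then for all products X of polynomials in noises B(h) with h orthogonal
   to f.  With He_(n+1) = x He_n - He_n' this integration by parts gives the
   orthogonality of the Hermite polynomials one coordinate at a time.  For the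
   coefficients of B(h), subtract from h its projection on the m_k with k in the
   support of b: what remains is uncorrelated with xi_b. *)
Require Import Defs.
From HB Require Import structures.
From mathcomp Require Import all_boot all_order all_algebra finmap.
From mathcomp Require Import all_classical all_reals all_analysis.
From mathcomp Require Import measurable_realfun ring lra.

Import Order.TTheory GRing.Theory Num.Theory.
Import numFieldNormedType.Exports.

Local Open Scope classical_set_scope.
Local Open Scope ring_scope.

(** * Moments of a centered Gaussian *)

Section gaussian_moments.
Context {R : realType}.
Implicit Types (s x : R) (n : nat).
Local Notation mu := (@lebesgue_measure R).

Lemma normal_pdf0E s x : s != 0 ->
  normal_pdf 0 s x = normal_peak s * expR (- (x ^+ 2 / (s ^+ 2 *+ 2))).
Proof. by move=> s0; rewrite normal_pdfE// /normal_fun subr0 mulNr. Qed.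

Lemma exprn_le_expR n x : 0 <= x -> x ^+ n <= n`!%:R * expR x.
Proof.
move=> x0; case: n => [|n]; first by rewrite expr0 fact0 mul1r -expR0 ler_expR.
rewrite -ler_pdivrMl ?ltr0n ?fact_gt0// mulrC.
by apply: le_trans (expR_ge1Dxn n x0); rewrite lerDr.
Qed.

(** Doubling the deviation leaves a spare factor exp(-3x^2/(8s^2)), which absorbs any power of [x].
    The bound gives both integrability and decay at infinity. *)
Lemma pow_normal_pdf_le s n : s != 0 -> exists2 C, 0 <= C &
  forall x, `|x ^+ n * normal_pdf 0 s x| <= C * normal_pdf 0 (2 * s) x.
Proof.
move=> s0; have s20 : 2 * s != 0 by rewrite mulf_neq0// pnatr_eq0.
have ss : 0 < s ^+ 2 by rewrite exprn_even_gt0.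
(* With [y] the spare exponent, x^2 = (8s^2/3) y and y^n <= n! exp(y), so [K] bounds x^(2n)
   exp(-y). *)
pose K := (8 * s ^+ 2 / 3) ^+ n * n`!%:R.
have K0 : 0 <= K by rewrite mulr_ge0// exprn_ge0// divr_ge0// mulr_ge0// ltW.
exists ((1 + K) * (normal_peak s / normal_peak (2 * s))) => [|x].
  by rewrite mulr_ge0 ?divr_ge0 ?normal_peak_ge0// addr_ge0.
have p0 := normal_peak_gt0 s20.
rewrite !normal_pdf0E// normrM [X in _ * X]ger0_norm; last first.
  by rewrite mulr_ge0 ?normal_peak_ge0 ?expR_ge0.
rewrite [leRHS]mulrA -[X in _ <= X * _]mulrA divfK ?(gt_eqF p0)//.
rewrite mulrCA [leRHS]mulrAC [leRHS]mulrC ler_wpM2l ?normal_peak_ge0//.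
pose y := 3 * x ^+ 2 / (8 * s ^+ 2).
have y0 : 0 <= y by apply: divr_ge0; rewrite mulr_ge0 ?sqr_ge0.
have -> : x ^+ 2 / (s ^+ 2 *+ 2) = y + x ^+ 2 / ((2 * s) ^+ 2 *+ 2).
  by rewrite /y; field.
rewrite opprD expRD mulrA ler_wpM2r ?expR_ge0// expRN ler_pdivrMr ?expR_gt0//.
(* Passing to 1 + x^(2n) removes odd powers, leaving only powers of x^2, that is of [y]. *)
rewrite mulrDl mul1r; apply: (@le_trans _ _ (1 + x ^+ 2 ^+ n)).
  rewrite -exprM mulnC exprM -real_normK ?num_real// normrX.
  set a := _ ^+ n; have : 0 <= (a - 1) ^+ 2 by rewrite sqr_ge0.
  have : 0 <= a by rewrite exprn_ge0.
  nra.
rewrite lerD//; first by rewrite -expR0 ler_expR.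
have -> : x ^+ 2 = (8 * s ^+ 2 / 3) * y by rewrite /y; field.
rewrite exprMn /K -[leRHS]mulrA ler_wpM2l ?exprn_le_expR// exprn_ge0//.
by rewrite divr_ge0// mulr_ge0// ltW.
Qed.

Lemma measurable_pow_normal_pdf s n (D : set R) :
  measurable_fun D (EFin \o (fun x => x ^+ n * normal_pdf 0 s x)).
Proof.
apply: measurable_funTS; apply/measurable_EFinP/measurable_funM => //.
exact: measurable_normal_pdf.
Qed.

Lemma integrable_pow_normal_pdf s n : s != 0 ->
  mu.-integrable [set: R] (fun x => (x ^+ n * normal_pdf 0 s x)%:E).
Proof.
move=> s0; have [C C0 leC] := pow_normal_pdf_le s n s0.
pose g (x : measurableTypeR R) := (C%:E * (normal_pdf 0 (2 * s) x)%:E)%E.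
apply: (@le_integrable _ _ _ _ _ _ _ g) => //.
- exact: measurable_pow_normal_pdf.
- move=> x _; rewrite /g -EFinM !abse_EFin lee_fin.
  by apply: le_trans (leC x) _; rewrite ler_norm.
- by apply: integrableZl => //; exact: integrable_normal_pdf.
Qed.

Lemma is_derive_normal_pdf s x : s != 0 ->
  is_derive x 1 (normal_pdf 0 s) (- (x / s ^+ 2) * normal_pdf 0 s x).
Proof.
move=> s0; set c := - (s ^+ 2 *+ 2)^-1.
have -> : normal_pdf 0 s =
    (fun y => normal_peak s *: (expR \o (fun y : R => c *: y ^+ 2)) y).
  apply/funext => y; rewrite normal_pdf0E// /GRing.scale/= /c mulNr.
  by congr (_ * expR (- _)); rewrite mulrC.
have dexp : is_derive x 1 (expR \o (fun y : R => c *: y ^+ 2))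
    (expR (c *: x ^+ 2) * (c *: (2 * x))).
  apply: is_derive1_comp; apply: is_derive_eq.
  by rewrite /GRing.scale /=; ring.
apply: is_derive_eq; rewrite /GRing.scale /= /c -mulr_natr.
by field.
Qed.

Lemma is_derive_pow_normal_pdf s n x : s != 0 ->
  is_derive x 1 (fun y => y ^+ n * normal_pdf 0 s y)
    (n%:R * (x ^+ n.-1 * normal_pdf 0 s x)
     - (s ^+ 2)^-1 * (x ^+ n.+1 * normal_pdf 0 s x)).
Proof.
move=> s0; have dpdf := is_derive_normal_pdf s x s0.
have dpow : is_derive x 1 (fun y : R => y ^+ n) (n%:R * x ^+ n.-1).
  have -> : (fun y : R => y ^+ n) = (@id R) ^+ n.
    by apply/funext => y; rewrite exprfctE.
  by apply: is_derive_eq; rewrite /GRing.scale/= mulr1.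
have := @is_deriveM _ _ (fun y : R => y ^+ n) (normal_pdf 0 s) x 1 _ _ dpow dpdf.
by move/is_derive_eq; apply; rewrite /GRing.scale/= [x ^+ n.+1]exprS; field.
Qed.

(** The bound for exponent [n.+1] gains a factor 1/(k+1). The sign [v] covers both ends of the real
    line. *)
Lemma pow_normal_pdf_cvg0 s n (v : R) : s != 0 -> `|v| = 1 ->
  (v * k.+1%:R) ^+ n * normal_pdf 0 s (v * k.+1%:R) @[k --> \oo] --> (0 : R).
Proof.
move=> s0 v1; have s20 : 2 * s != 0 by rewrite mulf_neq0// pnatr_eq0.
have [C C0 leC] := pow_normal_pdf_le s n.+1 s0.
pose K := C * normal_peak (2 * s).
apply: norm_cvg0; apply: (@squeeze_cvgr _ _ _ _ (fun=> 0) (fun k => K * k.+1%:R^-1)).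
- near=> k; rewrite normr_ge0/= ler_pdivlMr ?ltr0n//.
  apply: (@le_trans _ _ (C * normal_pdf 0 (2 * s) (v * k.+1%:R))); last first.
    by rewrite ler_wpM2l// normal_pdf_ub.
  apply: le_trans (leC _); rewrite exprS -mulrA [leRHS]normrM.
  by rewrite [X in _ <= X * _]normrM v1 mul1r normr_nat mulrC.
- exact: cvg_cst.
- rewrite -[X in _ --> X](mulr0 K); apply: cvgM; first exact: cvg_cst.
  exact: cvg_harmonic.
Unshelve. all: by end_near. Qed.

(** The derivative of x^n times the density integrates to 0 over the line, because the boundary
    terms vanish. For [n = 0] the value of [n.-1] is harmless: its coefficient is 0. *)
Lemma gaussian_stein s n : s != 0 ->
  (\int[mu]_x (x ^+ n.+1 * normal_pdf 0 s x) =
   n%:R * s ^+ 2 * \int[mu]_x (x ^+ n.-1 * normal_pdf 0 s x))%R.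
Proof.
move=> s0.
pose F (y : R) := y ^+ n * normal_pdf 0 s y.
pose f (y : measurableTypeR R) : R := n%:R * (y ^+ n.-1 * normal_pdf 0 s y)
     - (s ^+ 2)^-1 * (y ^+ n.+1 * normal_pdf 0 s y).
have dF (x : R) : is_derive x 1 F (f x) := is_derive_pow_normal_pdf s n x s0.
have cpow j : continuous (fun y : R => y ^+ j * normal_pdf 0 s y).
  move=> x; apply/differentiable_continuous; apply/derivable1_diffP.
  by have [] := is_derive_pow_normal_pdf s j x s0.
have cf : continuous (f : R -> R).
  by move=> x; apply: cvgB; apply: cvgM; do ?exact: cvg_cst; exact: cpow.
have cF : continuous F by exact: cpow.
have ipow j := @integrable_pow_normal_pdf s j s0.
have intf : mu.-integrable [set: R] (EFin \o f).
  rewrite (_ : _ \o _ = (fun x => n%:R%:E * (x ^+ n.-1 * normal_pdf 0 s x)%:E -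
     ((s ^+ 2)^-1)%:E * (x ^+ n.+1 * normal_pdf 0 s x)%:E)%E).
    by apply: integrableB => //; apply: integrableZl.
  by apply/funext => x /=; rewrite -!EFinM -EFinB.
have ftc k : (\int[mu]_(x in `[(- k.+1%:R)%R, k.+1%:R]) (f x)%:E =
    (F k.+1%:R - F (- k.+1%:R))%:E)%E.
  rewrite EFinB (@continuous_FTC2 _ f F)//.
  - by rewrite gt0_cp// ltr0n.
  - exact: continuous_subspaceT.
  - split=> [x _||]; first by have [] := dF x.
      exact: cvg_at_right_filter (cF _).
    exact: cvg_at_left_filter (cF _).
  - by move=> x _; rewrite derive1E derive_val.
have lim1 : (F k.+1%:R - F (- k.+1%:R))%:E @[k --> \oo] --> (0%:E : \bar R).
  apply: cvg_EFin; first by near=> k.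
  rewrite -[X in _ --> X]subr0; apply: cvgB.
    have := @pow_normal_pdf_cvg0 s n 1 s0 (normr1 _).
    by under eq_fun do rewrite mul1r.
  have := @pow_normal_pdf_cvg0 s n (-1) s0 (normrN1 _).
  by under eq_fun do rewrite mulN1r.
(* Dominated convergence: the restrictions of [f] to the growing intervals are bounded by |f|. *)
have lim2 : (\int[mu]_(x in `[(- k.+1%:R)%R, k.+1%:R]) (f x)%:E)%E @[k --> \oo] -->
    (\int[mu]_x (f x)%:E)%E.
  under eq_fun do rewrite integral_mkcond.
  apply: (dominated_cvg _ _ _ _ (integrable_abse intf)) => //.
  - move=> k; apply/(measurable_restrictT _ _).1 => //.
    by apply: measurable_funTS; have /integrableP[] := intf.
  - move=> x _; apply: cvg_near_cst; near=> k.
    rewrite patchE ifT// inE/= in_itv/= -ler_norml.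
    apply: (@le_trans _ _ k%:R); last by rewrite ler_nat.
    near: k; exact: nbhs_infty_ger.
  - move=> k x _; rewrite patchE /=; case: ifP => _; first exact: lexx.
    by rewrite /= normr0 lee_fin.
have int0 : (\int[mu]_x (f x)%:E = 0)%E.
  apply: (cvg_unique _ lim2) => //.
  rewrite (_ : (fun k => _) = (fun k => (F k.+1%:R - F (- k.+1%:R))%:E))//.
  by apply/funext => k; exact: ftc.
have : \int[mu]_x f x = 0 by rewrite /Rintegral int0.
rewrite RintegralB//; last 2 first.
  exact: (@integrableZl _ _ _ _ _ measurableT n%:R _ (ipow n.-1)).
  exact: (@integrableZl _ _ _ _ _ measurableT (s ^+ 2)^-1 _ (ipow n.+1)).
rewrite !RintegralZl//; do ?exact: ipow.
move/eqP; rewrite subr_eq0 => /eqP; rewrite mulrAC => ->.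
by rewrite mulrAC mulVf ?mul1r// sqrf_eq0.
Unshelve. all: by end_near. Qed.

End gaussian_moments.

(** * Integrals and moments of Gaussian random variables *)

Section gaussian_variables.
Context {R : realType} {d : measure_display} {T : measurableType d}.
Context {P : probability T R}.
Local Notation mu := (@lebesgue_measure R).

Lemma ge0_integral_gaussian (X : {RV P >-> R}) (s : R)
    (f : measurableTypeR R -> \bar R) : s != 0 ->
  (forall A : set R, measurable A -> distribution P X A = normal_prob 0 s A) ->
  measurable_fun [set: measurableTypeR R] f -> (forall x, (0 <= f x)%E) ->
  (\int[P]_w f (X w) = \int[mu]_x (f x * (normal_pdf 0 s x)%:E))%E.
Proof.
move=> s0 lawX mf f0.
pose nu : {finite_measure set (measurableTypeR R) -> \bar R} := normal_prob 0 s.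
have numu : nu `<< mu by exact: normal_prob_dominates.
have mX : @measurable_fun _ _ _ (measurableTypeR R) [set: T] X.
  exact: (@measurable_funPT _ _ _ _ X).
rewrite -(@ge0_integral_pushforward _ _ _ _ _ _ mX P setT f)//.
rewrite (@eq_measure_integral _ _ _ _ nu); last by move=> A mA _; exact: lawX.
rewrite -(Radon_Nikodym_SigmaFinite.change_of_variables numu)//.
apply: ae_eq_integral => //.
- apply: emeasurable_funM => //.
  exact: measurable_int (Radon_Nikodym_SigmaFinite.f_integrable numu).
- apply: emeasurable_funM => //; apply/measurable_EFinP.
  exact: measurable_normal_pdf.
(* The Radon-Nikodym derivative and the explicit density have the same integral over every
   measurable set. *)
- apply: ae_eqe_mul2l; apply: integral_ae_eq => //.
  + exact: Radon_Nikodym_SigmaFinite.f_integrable.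
  + by apply/measurable_EFinP; exact: measurable_normal_pdf.
  + by move=> E _ mE; rewrite -Radon_Nikodym_SigmaFinite.f_integral.
Qed.

Lemma integral_gaussian (X : {RV P >-> R}) (s : R) (f : R -> R) : s != 0 ->
  (forall A : set R, measurable A -> distribution P X A = normal_prob 0 s A) ->
  measurable_fun [set: R] f ->
  mu.-integrable [set: R] (fun x => (f x * normal_pdf 0 s x)%:E) ->
  P.-integrable [set: T] (EFin \o (f \o X)) /\
  \int[P]_w f (X w) = \int[mu]_x (f x * normal_pdf 0 s x).
Proof.
move=> s0 lawX mf intf; have mfX : measurable_fun [set: T] (f \o X).
  by apply: measurableT_comp => //; exact: measurable_funPT.
have mEf : @measurable_fun _ _ (measurableTypeR R) _ setT (EFin \o f).
  exact/measurable_EFinP.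
have pdf0 x : (0 <= (normal_pdf 0 s x)%:E)%E by rewrite lee_fin normal_pdf_ge0.
split.
  apply/integrableP; split; first exact/measurable_EFinP.
  have /integrableP[_] := intf; apply: le_lt_trans.
  rewrite (ge0_integral_gaussian X s (fun x => `|(f x)%:E|%E))//; last first.
    exact: measurableT_comp mEf.
  rewrite le_eqVlt; apply/orP; left; apply/eqP/eq_integral => x _.
  by rewrite EFinM abseM (gee0_abs (pdf0 x)).
(* The density is non-negative, so multiplying by it commutes with taking positive and negative
   parts. *)
congr fine; rewrite integralE [RHS]integralE; congr (_ - _)%E.
- transitivity (\int[P]_w (EFin \o f)^\+ (X w))%E.
    by apply: eq_integral => w _; rewrite !funeposE.
  rewrite (ge0_integral_gaussian X s (EFin \o f)^\+%E)//; last first.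
    exact: measurable_funepos.
  by apply: eq_integral => x _; rewrite !funeposE /= maxe_pMl// mul0e.
- transitivity (\int[P]_w (EFin \o f)^\- (X w))%E.
    by apply: eq_integral => w _; rewrite !funenegE.
  rewrite (ge0_integral_gaussian X s (EFin \o f)^\-%E)//; last first.
    exact: measurable_funeneg.
  by apply: eq_integral => x _; rewrite !funenegE /= maxe_pMl// mul0e -EFinM mulNr.
Qed.

(** The witness [v] is the variance: [s ^+ 2], or 0 in the degenerate case. It stays existential
    here, since the covariance of the noise determines it later. *)
Lemma centered_gaussian_pow (X : {RV P >-> R}) : centered_gaussian X ->
  (forall n, P.-integrable [set: T] (fun w => (X w ^+ n)%:E)) /\
  exists v : R, forall n,
    \int[P]_w (X w ^+ n.+1) = n%:R * v * \int[P]_w (X w ^+ n.-1).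
Proof.
have mX n : measurable_fun setT (fun w => (X w ^+ n)%:E).
  by apply/measurable_EFinP/measurable_funX; exact: measurable_funPT.
move=> [[s s0 lawX]|X0].
  have key n := @integral_gaussian X s (fun x => x ^+ n) s0 lawX
    (measurable_funX _ (@measurable_id _ _ _)) (integrable_pow_normal_pdf s n s0).
  split=> [n|]; first by have [] := key n.
  by exists (s ^+ 2) => n; have [_ ->] := key n.+1; have [_ ->] := key n.-1;
    exact: gaussian_stein.
(* Only positive powers vanish almost everywhere; the power 0 is the constant 1 even where [X] is
   0. *)
have Xn0 n : {ae P, forall w, [set: T] w -> (X w ^+ n.+1)%:E = 0%E}.
  by apply: filterS X0 => w -> _; rewrite expr0n.
split=> [[|n]|].
- under eq_fun do rewrite expr0.
  exact: (@finite_measure_integrable_cst _ _ _ P setT 1).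
- apply/integrableP; split; first exact: mX.
  rewrite (@ae_eq_integral _ _ _ P setT (cst 0%E))//; first by rewrite integral0.
    exact: measurableT_comp.
  by apply: filterS (Xn0 n) => w /[apply] ->; rewrite abse0.
- exists 0 => n; rewrite mulr0 mul0r /Rintegral.
  rewrite (@ae_eq_integral _ _ _ P setT (cst 0%E))//; first by rewrite integral0.
  exact: Xn0.
Qed.

End gaussian_variables.

(** * The algebra of random variables with moments of all orders *)

Section all_moments.
Context {R : realType} {d : measure_display} {T : measurableType d}.
Context {P : probability T R}.
Implicit Types (X Y : T -> R) (n : nat).

(** Closure under sums and products makes this class settle the integrability of every polynomial
    expression in the noise. *)
Definition all_moments X : Prop :=
  forall n, P.-integrable [set: T] (fun w => (X w ^+ n)%:E).

Lemma all_moments_integrable X : all_moments X ->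
  P.-integrable [set: T] (EFin \o X).
Proof. by move=> /(_ 1%N). Qed.

Lemma all_moments_measurable X : all_moments X -> measurable_fun [set: T] X.
Proof.
by move=> /all_moments_integrable /measurable_int /measurable_EFinP.
Qed.

Lemma all_moments_cst (c : R) : all_moments (cst c).
Proof.
by move=> n; exact: (@finite_measure_integrable_cst _ _ _ P setT (c ^+ n)).
Qed.

(** The elementary bound |xy|^n <= x^(2n) + y^(2n) does the work of the Cauchy-Schwarz
    inequality. *)
Lemma all_momentsM X Y : all_moments X -> all_moments Y ->
  all_moments (fun w => X w * Y w).
Proof.
move=> mX mY n; have iXY := integrableD measurableT (mX (2 * n)%N) (mY (2 * n)%N).
apply: (@le_integrable _ _ _ _ _ measurableT _ _ _ _ iXY).
  by apply/measurable_EFinP/measurable_funX/measurable_funM;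
    exact: all_moments_measurable.
move=> w _; rewrite /= lee_fin [leRHS]ger0_norm; last first.
  by rewrite addr_ge0 // exprM exprn_ge0// sqr_ge0.
rewrite exprMn ler_norml !(mulnC 2%N) !exprM.
by apply/andP; split; nra.
Qed.

Lemma all_momentsX X n : all_moments X -> all_moments (fun w => X w ^+ n).
Proof. by move=> mX k; under eq_fun do rewrite -exprM; exact: mX. Qed.

Lemma all_momentsZ (c : R) X : all_moments X -> all_moments (fun w => c * X w).
Proof. by move=> mX; exact: all_momentsM (all_moments_cst c) mX. Qed.

Lemma all_momentsD X Y : all_moments X -> all_moments Y ->
  all_moments (fun w => X w + Y w).
Proof.
move=> mX mY n.
under eq_fun do rewrite exprDn -sumEFin.
apply: integrable_sum => // i _.
under eq_fun do rewrite -mulr_natl.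
by apply/all_moments_integrable/all_momentsZ/all_momentsM; exact: all_momentsX.
Qed.

Lemma all_moments_horner (p : {poly R}) X : all_moments X ->
  all_moments (fun w => p.[X w]).
Proof.
move=> mX; elim/poly_ind: p => [|p c IH].
  by under eq_fun do rewrite horner0; exact: all_moments_cst.
under eq_fun do rewrite hornerMXaddC.
by apply: all_momentsD; [exact: all_momentsM|exact: all_moments_cst].
Qed.

Lemma all_moments_prod (I : Type) (s : seq I) (X : I -> T -> R) :
  (forall i, all_moments (X i)) -> all_moments (fun w => \prod_(i <- s) X i w).
Proof.
move=> mX; elim: s => [|i s IH].
  by under eq_fun do rewrite big_nil; exact: all_moments_cst.
by under eq_fun do rewrite big_cons; exact: all_momentsM.
Qed.

Lemma RintegralD_moments X Y : all_moments X -> all_moments Y ->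
  \int[P]_w (X w + Y w) = \int[P]_w X w + \int[P]_w Y w.
Proof. by move=> mX mY; rewrite RintegralD//; exact: all_moments_integrable. Qed.

Lemma RintegralZ_moments c X : all_moments X ->
  \int[P]_w (c * X w) = c * \int[P]_w X w.
Proof. by move=> mX; rewrite RintegralZl//; exact: all_moments_integrable. Qed.

Lemma Rintegral_sum_moments (I : Type) (s : seq I) (X : I -> T -> R) :
  (forall i, all_moments (X i)) ->
  \int[P]_w (\sum_(i <- s) X i w) = \sum_(i <- s) \int[P]_w X i w.
Proof.
move=> mX; elim: s => [|i s IH].
  by under eq_Rintegral do rewrite big_nil; rewrite big_nil Rintegral_cst// mul0r.
under eq_Rintegral do rewrite big_cons.
rewrite big_cons RintegralD_moments ?IH//.
elim: s {IH} => [|j s IH].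
  by under eq_fun do rewrite big_nil; exact: all_moments_cst.
by under eq_fun do rewrite big_cons; exact: all_momentsD.
Qed.

Lemma Rintegral_cst_prob (c : R) : \int[P]_w c = c.
Proof. by rewrite Rintegral_cst// [X in fine X]probability_setT/= mulr1. Qed.

Lemma ae_eq_Rintegral X Y : measurable_fun [set: T] X ->
  measurable_fun [set: T] Y -> {ae P, forall w, X w = Y w} ->
  \int[P]_w X w = \int[P]_w Y w.
Proof.
move=> mX mY XY; congr fine; apply: ae_eq_integral => //; try exact/measurable_EFinP.
by apply: filterS XY => w -> _.
Qed.

End all_moments.

(** * Gaussian integration by parts for the white noise *)

Section inner_product.
Context {R : realType} {H : completeNormedModType R}.
Context {ip : {dot H for (@idfun R)}}.
Implicit Types (f g h : H).

Lemma ipC f g : ip f g = ip g f.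
Proof. by rewrite hermitian_subproof expr0 mul1r. Qed.

Lemma ipDl f g h : ip (f + g) h = ip f h + ip g h.
Proof. exact: linearDl. Qed.

Lemma ipZl (a : R) f h : ip (a *: f) h = a * ip f h.
Proof. exact: linearZl_LR. Qed.

Lemma ipDr f g h : ip f (g + h) = ip f g + ip f h.
Proof. by rewrite ipC ipDl !(ipC f). Qed.

Lemma ipZr (a : R) f h : ip f (a *: h) = a * ip f h.
Proof. by rewrite ipC ipZl (ipC f). Qed.

End inner_product.

(** The difference vanishes at more natural numbers than its degree allows. This lets coefficients
    be compared in identities valid for every [t]. *)
Lemma poly_eq_horner (R : numDomainType) (p q : {poly R}) :
  (forall t, p.[t] = q.[t]) -> p = q.
Proof.
move=> pq; apply/eqP; rewrite -subr_eq0; apply/eqP.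
apply: (@roots_geq_poly_eq0 _ _ [seq i%:R | i <- iota 0 (size (p - q))]).
- by apply/allP => x _; rewrite rootE hornerD hornerN pq subrr.
- by rewrite map_inj_uniq ?iota_uniq// => i j /eqP; rewrite eqr_nat => /eqP.
- by rewrite size_map size_iota.
Qed.

Section white_noise_stein.
Context {R : realType} {d : measure_display} {T : measurableType d}.
Context {P : probability T R} {H : completeNormedModType R}.
Context {ip : {dot H for (@idfun R)}} {B : H -> {RV P >-> R}}.
Hypothesis hB : white_noise ip B.
Implicit Types (f g h : H) (X Y : T -> R) (n : nat) (p : {poly R}).

Lemma noise_moments f : all_moments (P := P) (B f).
Proof.
by move=> n; have [gaus _ _] := hB; have [+ _] := centered_gaussian_pow _ (gaus f).
Qed.

Lemma noise_cov f g : \int[P]_w (B f w * B g w) = ip f g.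
Proof.
have [_ _ cov] := hB; have := cov f g; rewrite unlock => cov_fg.
by rewrite /Rintegral cov_fg.
Qed.

Lemma noise_linear (t : R) g h :
  {ae P, forall w, B (g + t *: h) w = B g w + t * B h w}.
Proof.
have [_ lin _] := hB; rewrite addrC; apply: filterS (lin t h g) => w ->.
by rewrite addrC.
Qed.

Lemma noise_pow f n : \int[P]_w (B f w ^+ n.+1) =
  n%:R * ip f f * \int[P]_w (B f w ^+ n.-1).
Proof.
have [gaus _ _] := hB; have [_ [v momv]] := centered_gaussian_pow _ (gaus f).
(* The recursion at exponent 1 reads E[B(f)^2] = v. *)
suff -> : ip f f = v by exact: momv.
rewrite -noise_cov; have := momv 1%N; under eq_Rintegral do rewrite expr2.
under [X in _ = _ * X]eq_Rintegral do rewrite expr0.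
by move=> ->; rewrite mul1r Rintegral_cst_prob mulr1.
Qed.

(** The binomial expansion of E[B(g + t h)^n X] as a polynomial in [t]; polarization compares its
    coefficients of degree 1. *)
Definition shift_poly g h n X : {poly R} :=
  \poly_(i < n.+1) ('C(n, i)%:R * \int[P]_w (B g w ^+ (n - i) * B h w ^+ i * X w)).

Lemma horner_shift_poly g h n X (t : R) : all_moments (P := P) X ->
  (shift_poly g h n X).[t] = \int[P]_w (B (g + t *: h) w ^+ n * X w).
Proof.
move=> mX; have mB := noise_moments; symmetry.
(* The null set where linearity fails depends on [t], so the noise is expanded only under the
   integral. *)
rewrite (ae_eq_Rintegral _ (fun w => (B g w + t * B h w) ^+ n * X w)).
- rewrite horner_poly.
  under eq_Rintegral do rewrite exprDn big_distrl/=.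
  have mi i : all_moments (P := P) (fun w => B g w ^+ (n - i) * B h w ^+ i * X w).
    by do ?apply: all_momentsM => //; exact: all_momentsX.
  rewrite (@eq_Rintegral _ _ _ P setT (fun w => \sum_(i < n.+1)
     ('C(n, i)%:R * t ^+ i) * (B g w ^+ (n - i) * B h w ^+ i * X w))); last first.
    move=> w _; apply: eq_bigr => i _.
    by rewrite exprMn -mulr_natl; ring.
  rewrite Rintegral_sum_moments => [|i]; last exact: all_momentsZ.
  by apply: eq_bigr => i _; rewrite RintegralZ_moments//; ring.
- by apply/all_moments_measurable/all_momentsM => //; exact: all_momentsX.
- apply/all_moments_measurable/all_momentsM => //; apply: all_momentsX.
  by apply: all_momentsD => //; exact: all_momentsZ.
- by apply: filterS (noise_linear t g h) => w ->.
Qed.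

Lemma coef0_shift_poly g h n X :
  (shift_poly g h n X)`_0 = \int[P]_w (B g w ^+ n * X w).
Proof.
by rewrite coef_poly bin0 mul1r subn0; under eq_Rintegral do rewrite expr0 mulr1.
Qed.

Lemma coef1_shift_poly g h n X : (shift_poly g h n X)`_1 =
  n%:R * \int[P]_w (B g w ^+ n.-1 * (B h w * X w)).
Proof.
rewrite coef_poly; case: n => [|n]; first by rewrite ltnn mul0r.
rewrite bin1 subn1; congr (_ * _).
by under eq_Rintegral do rewrite expr1 -mulrA.
Qed.

(* [X] behaves as a functional whose derivative in the direction [f] vanishes:
   this is Gaussian integration by parts, tested on the powers of the noise. *)
Definition stein f X : Prop := all_moments (P := P) X /\
  forall g n, \int[P]_w (B f w * B g w ^+ n * X w) =
    n%:R * ip f g * \int[P]_w (B g w ^+ n.-1 * X w).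

(* Polarization: the coefficient of t in the moment recursion of B (g + t f). *)
Lemma stein1 f : stein f (cst 1).
Proof.
split=> [|g]; first exact: all_moments_cst.
pose one : T -> R := cst 1; have mone : all_moments (P := P) one.
  exact: all_moments_cst.
suff key n : \int[P]_w (B g w ^+ n * (B f w * one w)) =
    n%:R * ip f g * \int[P]_w (B g w ^+ n.-1 * one w).
  by move=> n; rewrite -key; apply: eq_Rintegral => w _; rewrite /one/=; ring.
have E1 h k : \int[P]_w (B h w ^+ k * one w) = \int[P]_w (B h w ^+ k).
  by apply: eq_Rintegral => w _; rewrite mulr1.
elim/ltn_ind: n => k IH.
(* The moment recursion at g + t f, where |g + t f|^2 = |g|^2 + 2 t (f, g) + t^2 |f|^2. *)
have polE : shift_poly g f k.+1 one = k%:R *: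
    (((ip g g)%:P + (2 * ip f g) *: 'X + (ip f f) *: 'X^2)
      * shift_poly g f k.-1 one).
  apply: poly_eq_horner => t; rewrite hornerZ hornerM !hornerD !hornerZ.
  rewrite !hornerC hornerX hornerXn !horner_shift_poly//.
  rewrite !E1 noise_pow !ipDl !ipDr !ipZl !ipZr (ipC g f); ring.
have := congr1 (fun p => p`_1) polE.
rewrite coef1_shift_poly coefZ coefM !big_ord_recl big_ord0 /=.
rewrite !(coefD, coefC, coefZ, coefX, coefXn) /= /bump /= subn0 subnn.
rewrite coef0_shift_poly coef1_shift_poly !(mulr0, mulr1, addr0, add0r) => E.
apply: (mulfI (x := k.+1%:R)); first by rewrite pnatr_eq0.
(* Before the case split, the right side is k (2 (f, g) E[B(g)^(k-1)] + |g|^2 (k-1)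
   E[B(f) B(g)^(k-2)]). Induction at k - 2 and [noise_pow] make the last term (k-1) (f, g)
   E[B(g)^(k-1)], so the factors combine to k (k+1). *)
rewrite {}E; case: k IH {polE} => [|[|k]] IH; rewrite ?mul0r ?mulr0//=; first by ring.
rewrite (IH k)// !E1 (noise_pow g k); ring.
Qed.

(* Polarization again, now in the direction h, where (f, g + t h) = (f, g). *)
Lemma steinM f h X : stein f X -> ip f h = 0 -> stein f (fun w => B h w * X w).
Proof.
move=> [mX sX] fh0; split=> [|g n]; first exact/all_momentsM/mX/noise_moments.
have mfX := all_momentsM _ _ (noise_moments f) mX.
(* Exponent [n.+1] is taken because extracting the coefficient of [t] lowers it by one; the
   resulting factor [n.+1] occurs on both sides and cancels. *)
have polE : shift_poly g h n.+1 (fun w => B f w * X w) =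
    (n.+1%:R * ip f g) *: shift_poly g h n X.
  apply: poly_eq_horner => t; rewrite hornerZ !horner_shift_poly//.
  have := sX (g + t *: h) n.+1; rewrite ipDr ipZr fh0 mulr0 addr0 => <-.
  by apply: eq_Rintegral => w _; ring.
have := congr1 (fun p => p`_1) polE; rewrite coefZ !coef1_shift_poly -[RHS]mulrA.
have nz : n.+1%:R != 0 :> R by rewrite pnatr_eq0.
move=> /(mulfI nz)/= E; rewrite -mulrA [RHS]mulrCA -E.
by apply: eq_Rintegral => w _; ring.
Qed.

Lemma steinD f X Y : stein f X -> stein f Y -> stein f (fun w => X w + Y w).
Proof.
move=> [mX sX] [mY sY]; split=> [|g n]; first exact: all_momentsD.
have mB := noise_moments.
have mg k := all_momentsX _ k (mB g).
under eq_Rintegral do rewrite mulrDr.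
rewrite RintegralD_moments ?sX ?sY; try by do ?apply: all_momentsM.
under [in RHS]eq_Rintegral do rewrite mulrDr.
by rewrite RintegralD_moments ?mulrDr//; apply: all_momentsM.
Qed.

Lemma steinZ f (c : R) X : stein f X -> stein f (fun w => c * X w).
Proof.
move=> [mX sX]; split=> [|g n]; first exact: all_momentsZ.
have mB := noise_moments.
have mg k := all_momentsX _ k (mB g).
under eq_Rintegral do rewrite mulrCA.
rewrite RintegralZ_moments ?sX; last by do ?apply: all_momentsM.
under [in RHS]eq_Rintegral do rewrite mulrCA.
by rewrite RintegralZ_moments 1?[RHS]mulrCA//; apply: all_momentsM.
Qed.

Lemma stein_horner f h p X : stein f X -> ip f h = 0 ->
  stein f (fun w => p.[B h w] * X w).
Proof.
move=> sX fh0; elim/poly_ind: p => [|p c IH].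
  by under eq_fun do rewrite horner0; exact: steinZ.
under eq_fun do rewrite hornerMXaddC mulrDl mulrAC mulrC.
by apply: steinD; [exact: steinM|exact: steinZ].
Qed.

(** Stands in for the independence of [B f] from noises in directions orthogonal to [f]. *)
Lemma stein_prod f (s : seq nat) (m : nat -> H) (p : nat -> {poly R}) :
  (forall k, k \in s -> ip f (m k) = 0) ->
  stein f (fun w => \prod_(k <- s) (p k).[B (m k) w]).
Proof.
elim: s => [|k s IH] fm.
  by under eq_fun do rewrite big_nil; exact: stein1.
under eq_fun do rewrite big_cons.
apply: stein_horner; last by rewrite fm ?mem_head.
by apply: IH => j js; rewrite fm// inE js orbT.
Qed.

(** The case [g = f] of [stein], extended from monomials to [p] by linearity. *)
Lemma stein_deriv f p Z : stein f Z -> ip f f = 1 ->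
  \int[P]_w (B f w * p.[B f w] * Z w) = \int[P]_w (p^`().[B f w] * Z w).
Proof.
move=> [mZ sZ] ff1; have mB := noise_moments f.
have mp q : all_moments (P := P) (fun w => q.[B f w]) by exact: all_moments_horner.
rewrite -[p]coefK poly_def; elim/big_ind: _ => [|p1 p2 E1 E2|i _].
- by apply: eq_Rintegral => w _; rewrite deriv0 horner0 mulr0.
- rewrite derivD; under eq_Rintegral do rewrite hornerD mulrDr mulrDl.
  under [in RHS]eq_Rintegral do rewrite hornerD mulrDl.
  rewrite !RintegralD_moments ?E1 ?E2//; do ?apply: all_momentsM => //.
- rewrite derivZ derivXn.
  under eq_Rintegral do rewrite hornerZ hornerXn mulrCA -mulrA.
  under [in RHS]eq_Rintegral do rewrite hornerZ hornerMn hornerXn -mulr_natl -!mulrA.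
  rewrite !RintegralZ_moments ?sZ ?ff1 ?mulr1//.
  + by apply: all_momentsM => //; exact: all_momentsX.
  + by apply/all_momentsZ/all_momentsM => //; exact: all_momentsX.
  + by do ?apply: all_momentsM => //; exact: all_momentsX.
Qed.

End white_noise_stein.

(** * Multi-indices *)

Section multi_indices.
Implicit Types (a b g : mindex) (j k : nat).

Lemma maddE a b j : madd a b j = (a j + b j)%N.
Proof.
by rewrite fsfun_fun; case: ifP => // /negbT; rewrite inE negb_or => /andP[ja jb];
  rewrite !fsfun_dflt.
Qed.

Lemma msubE a b j : msub a b j = (a j - b j)%N.
Proof. by rewrite fsfun_fun; case: ifP => // /negbT ja; rewrite fsfun_dflt. Qed.

Lemma munitE k j : munit k j = (j == k).
Proof. by rewrite fsfun_fun inE; case: eqP. Qed.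

Lemma finsupp_munit k : finsupp (munit k) = [fset k]%fset.
Proof. by apply/fsetP => j; rewrite mem_finsupp munitE inE; case: (j == k). Qed.

Lemma msub_munitK g k : k \in finsupp g -> madd (munit k) (msub g (munit k)) = g.
Proof.
rewrite mem_finsupp => gk; apply/fsfunP => j; rewrite maddE msubE munitE.
by case: eqP => [->|_]; rewrite ?subn0// subnKC// lt0n.
Qed.

Lemma madd_munitK k a : msub (madd (munit k) a) (munit k) = a.
Proof. by apply/fsfunP => j; rewrite msubE maddE addKn. Qed.

Lemma mem_madd_munit k a : k \in finsupp (madd (munit k) a).
Proof. by rewrite mem_finsupp maddE munitE eqxx. Qed.

(** Injectivity needs the support: at an index outside it, truncated subtraction returns [g]
    itself. *)
Lemma msub_munit_inj g :
  {in finsupp g &, injective (fun k => msub g (munit k))}.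
Proof.
move=> j k; rewrite !mem_finsupp => gj gk /fsfunP /(_ j).
rewrite !msubE !munitE eqxx; case: eqP => // _; rewrite subn0 => /eqP.
by rewrite subn1 -[X in _ == X]prednK ?lt0n// eqn_leq ltnn andbF.
Qed.

Lemma mfactE a (A : {fset nat}) : (finsupp a `<=` A)%fset ->
  mfact a = (\prod_(k <- A) (a k)`!)%N.
Proof.
move=> aA; rewrite /mfact (big_fset_incl _ aA)// => k _ ka.
by rewrite fsfun_dflt.
Qed.

Lemma mfact_madd_munit k a :
  mfact (madd (munit k) a) = ((a k).+1 * mfact a)%N.
Proof.
pose A := (finsupp (madd (munit k) a) `|` finsupp a)%fset.
rewrite (mfactE _ A) ?fsubsetUl// (mfactE a A) ?fsubsetUr//.
have kA : k \in A by rewrite inE mem_madd_munit.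
rewrite !(big_fsetD1 k kA)/= maddE munitE eqxx factS mulnA; congr (_ * _)%N.
rewrite big_seq [RHS]big_seq; apply: eq_bigr => j; rewrite !inE => /andP[jk _].
by rewrite maddE munitE (negbTE jk).
Qed.

Lemma mfact_munit k : mfact (munit k) = 1%N.
Proof.
by rewrite (mfactE _ [fset k]%fset) ?finsupp_munit// big_seq_fset1 munitE eqxx.
Qed.

Lemma mfact_gt0 a : (0 < mfact a)%N.
Proof. by rewrite prodn_gt0// => k; exact: fact_gt0. Qed.

End multi_indices.

(** * Hermite polynomials and the chaos basis *)

Section hermite_polynomials.
Context {R : realType}.
Implicit Types (n k : nat) (t : R).

(** The raising recursion for the probabilists' Hermite polynomials, in the form suited to
    integration by parts. *)
Fixpoint hermite_poly n : {poly R} :=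
  if n is k.+1 then 'X * hermite_poly k - (hermite_poly k)^`() else 1.

Lemma deriv_hermite_poly n :
  (hermite_poly n)^`() = n%:R *: hermite_poly n.-1.
Proof.
elim: n => [|n IH]; first by rewrite derivC scale0r.
case: n IH => [_|n IH].
  by rewrite /= derivC subr0 mulr1 derivX scale1r.
rewrite [hermite_poly n.+2]/(_ - _) derivB derivM derivX mul1r IH derivZ -scalerAr.
rewrite -addrA -scalerBr -[_ - _]/(hermite_poly n.+1).
by rewrite -[X in X + _]scale1r -scalerDl nat1r.
Qed.

Lemma hermiteE n t : hermite n t = (hermite_poly n).[t].
Proof.
pose G (s : R) := expR (- (s ^+ 2 / 2)).
have dG (s : R) : is_derive s 1 G (- s * G s).
  have -> : G = expR \o (fun y : R => - 2^-1 *: y ^+ 2).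
    by apply/funext => y; rewrite /G/= /GRing.scale/= mulNr mulrC.
  have d2 : is_derive s 1 (fun y : R => - 2^-1 *: y ^+ 2) (- s).
    by apply: is_derive_eq; rewrite /GRing.scale/=; field.
  have /is_derive_eq := is_derive1_comp (is_derive_expR _) d2.
  by apply; rewrite mulrC.
(* Since G' = -s G, differentiating He_k G gives (He_k' - s He_k) G = -He_(k+1) G. *)
have dn k : derive1n k G = (fun s => (-1) ^+ k * (hermite_poly k).[s] * G s).
  elim: k => [|k IH].
    by apply/funext => s; rewrite derive1n0 expr0 mul1r hornerC mul1r.
  rewrite derive1nS IH; apply/funext => s; rewrite derive1E.
  have dp : is_derive s 1 (fun y : R => (-1) ^+ k *: (hermite_poly k).[y])
      ((-1) ^+ k *: (hermite_poly k)^`().[s]) by apply: is_derive_eq.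
  have := @is_deriveM _ _ _ _ s 1 _ _ dp (dG s).
  move=> /@derive_val; rewrite /GRing.scale/= => ->.
  by rewrite exprS hornerD hornerN hornerM hornerX; ring.
rewrite /hermite -/G dn /G expRN.
have e0 := gt_eqF (expR_gt0 (t ^+ 2 / 2)); set e := expR _ in e0 *.
transitivity (((-1) ^+ n * (-1) ^+ n) * (e * e^-1) * (hermite_poly n).[t]).
  by ring.
by rewrite -expr2 sqrr_sign divff ?e0// !mul1r.
Qed.

End hermite_polynomials.

(** * Orthonormality of the chaos basis and chaos coefficients of the noise *)

Section chaos_orthonormality.
Context {R : realType} {d : measure_display} {T : measurableType d}.
Context {P : probability T R} {H : completeNormedModType R}.
Context {ip : {dot H for (@idfun R)}} {B : H -> {RV P >-> R}} {m : nat -> H}.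
Hypotheses (hB : white_noise ip B) (hm : orthonormal_basis ip m).
Implicit Types (f h : H) (a b : mindex) (n k j : nat) (s : seq nat).

(** Integrating x He_n q by parts produces He_n' q + He_n q', and the recursion for He_(n+1)
    subtracts exactly He_n' q. *)
Lemma hermite_stein f Z n (q : {poly R}) : stein (ip := ip) (B := B) f Z -> ip f f = 1 ->
  \int[P]_w ((hermite_poly n.+1 * q).[B f w] * Z w) =
  \int[P]_w ((hermite_poly n * q^`()).[B f w] * Z w).
Proof.
move=> sZ ff1; have [mZ _] := sZ; have mB := noise_moments hB f.
have mp p : all_moments (P := P) (fun w => p.[B f w] * Z w).
  by apply: all_momentsM => //; exact: all_moments_horner.
rewrite (@eq_Rintegral _ _ _ P setT (fun w =>
    B f w * (hermite_poly n * q).[B f w] * Z w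
    + (-1) * (((hermite_poly n)^`() * q).[B f w] * Z w))); last first.
  by move=> w _; rewrite /= !(hornerM, hornerD, hornerN, hornerX); ring.
rewrite RintegralD_moments; last exact: all_momentsZ; last first.
  by do ?apply: all_momentsM => //; exact: all_moments_horner.
rewrite RintegralZ_moments// (stein_deriv hB)// derivM mulN1r.
rewrite [X in X - _ = _](@eq_Rintegral _ _ _ P setT (fun w =>
    ((hermite_poly n)^`() * q).[B f w] * Z w
    + ((hermite_poly n * q^`()).[B f w] * Z w))); last first.
  by move=> w _; rewrite hornerD mulrDl.
by rewrite RintegralD_moments// addrAC subrr add0r.
Qed.

(** Each integration by parts lowers both degrees by one, until one of them is 0. The factor [Z]
    carries the remaining coordinates. *)
Lemma hermite_orthogonal f Z n k : stein (ip := ip) (B := B) f Z -> ip f f = 1 ->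
  \int[P]_w ((hermite_poly n * hermite_poly k).[B f w] * Z w) =
  (n == k)%:R * n`!%:R * \int[P]_w Z w.
Proof.
move=> sZ ff1; have [mZ _] := sZ; have mB := noise_moments hB f.
have mp p : all_moments (P := P) (fun w => p.[B f w] * Z w).
  by apply: all_momentsM => //; exact: all_moments_horner.
have H0 k' : \int[P]_w ((hermite_poly k'.+1 * 1).[B f w] * Z w) = 0.
  rewrite hermite_stein// derivC mulr0.
  under eq_Rintegral do rewrite horner0 mul0r.
  exact: Rintegral_cst_prob.
elim: n k => [|n IH] [|k].
- transitivity (\int[P]_w Z w); last by rewrite fact0 !mul1r.
  by apply: eq_Rintegral => w _; rewrite /= mulr1 hornerC mul1r.
- by rewrite [hermite_poly 0 * _]mulrC H0 !mul0r.
- by rewrite H0 !mul0r.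
- rewrite hermite_stein// deriv_hermite_poly -scalerAr.
  under eq_Rintegral do rewrite hornerZ -mulrA.
  rewrite RintegralZ_moments// IH eqSS factS natrM.
  by have [->|_] := eqVneq n k; rewrite ?mul0r ?mulr0//; ring.
Qed.

Definition hermite_normal n : {poly R} := (Num.sqrt n`!%:R)^-1 *: hermite_poly n.

Lemma hermite_normal_orthonormal f Z n k : stein (ip := ip) (B := B) f Z -> ip f f = 1 ->
  \int[P]_w ((hermite_normal n * hermite_normal k).[B f w] * Z w) =
  (n == k)%:R * \int[P]_w Z w.
Proof.
move=> sZ ff1; have [mZ _] := sZ; have mB := noise_moments hB f.
rewrite /hermite_normal -scalerAl -scalerAr scalerA.
under eq_Rintegral do rewrite hornerZ -mulrA.
rewrite RintegralZ_moments; last by apply: all_momentsM => //; exact: all_moments_horner.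
rewrite hermite_orthogonal//; have [->|_] := eqVneq n k; last by rewrite !mul0r mulr0.
rewrite !mul1r mulrA -invfM -expr2 sqr_sqrtr ?ler0n// mulVf ?mul1r//.
Qed.

Lemma hermite_normal_prod_orthonormal s (a b : nat -> nat) : uniq s ->
  \int[P]_w (\prod_(k <- s) (hermite_normal (a k) * hermite_normal (b k)).[B (m k) w]) =
  \prod_(k <- s) (a k == b k)%:R.
Proof.
have [orth _] := hm.
elim: s => [|k s IH].
  by under eq_Rintegral do rewrite big_nil; rewrite big_nil Rintegral_cst_prob.
move=> /= /andP[ks us]; under eq_Rintegral do rewrite big_cons.
rewrite hermite_normal_orthonormal ?orth ?eqxx// ?big_cons ?IH//.
apply: (stein_prod hB) => j js; rewrite orth; case: eqP => // kj.
by rewrite kj js in ks.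
Qed.

(** Indices outside the support contribute He_0 = 1, so two multi-indices can share one index
    set. *)
Lemma xiE a (A : {fset nat}) w : (finsupp a `<=` A)%fset ->
  xi B m a w = \prod_(k <- A) (hermite_normal (a k)).[B (m k) w].
Proof.
move=> aA; rewrite /xi -(big_fset_incl _ aA) => [|k _ ka].
  by apply: eq_bigr => k _; rewrite hermiteE hornerZ mulrC.
by rewrite fsfun_dflt// /hermite_normal fact0 sqrtr1 invr1 scale1r hornerC.
Qed.

Lemma xi_moments a : all_moments (P := P) (xi B m a).
Proof.
rewrite (_ : xi B m a = (fun w =>
    \prod_(k <- finsupp a) (hermite_normal (a k)).[B (m k) w])).
  by apply: all_moments_prod => k; apply: all_moments_horner; exact: noise_moments hB _.
by apply/funext => w; exact: xiE.
Qed.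

Lemma xi_orthonormal a b : \int[P]_w (xi B m a w * xi B m b w) = (a == b)%:R.
Proof.
pose A := (finsupp a `|` finsupp b)%fset.
under eq_Rintegral do rewrite (xiE a A) ?fsubsetUl// (xiE b A) ?fsubsetUr// -big_split/=.
under eq_Rintegral do under eq_bigr do rewrite -hornerM.
rewrite hermite_normal_prod_orthonormal ?fset_uniq//.
have [->|ab] := eqVneq a b; first by rewrite big1// => k _; rewrite eqxx.
have /existsNP[k akbk] : ~ a =1 b by move=> /fsfunP /eqP; exact/negP.
have kA : k \in A.
  apply: contra_notT akbk; rewrite inE negb_or => /andP[ka kb].
  by rewrite !fsfun_dflt.
by rewrite (big_fsetD1 k)//= (introF eqP akbk) mul0r.
Qed.

Lemma chaos_coefE (X : T -> R) a :
  chaos_coef B m X a = \int[P]_w (X w * xi B m a w).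
Proof. by rewrite /chaos_coef unlock. Qed.

Lemma chaos_coef_xi a b : chaos_coef B m (xi B m a) b = (a == b)%:R.
Proof. by rewrite chaos_coefE xi_orthonormal. Qed.

Lemma xi_munit k w : xi B m (munit k) w = B (m k) w.
Proof.
rewrite (xiE _ [fset k]%fset) ?finsupp_munit// big_seq_fset1 munitE eqxx.
rewrite /hermite_normal (_ : 1`! = 1)%N// sqrtr1 invr1 scale1r/=.
by rewrite derivC subr0 mulr1 hornerX.
Qed.

Lemma chaos_coef_noise_linear (t : R) f h b :
  chaos_coef B m (B (f + t *: h)) b =
  chaos_coef B m (B f) b + t * chaos_coef B m (B h) b.
Proof.
have mB := noise_moments hB; have mxi := xi_moments b.
rewrite !chaos_coefE (ae_eq_Rintegral _ (fun w =>
  B f w * xi B m b w + t * (B h w * xi B m b w))).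
- by rewrite RintegralD_moments ?RintegralZ_moments//; do ?apply: all_momentsZ;
    exact: all_momentsM.
- exact: all_moments_measurable (all_momentsM _ _ (mB _) mxi).
- apply: (@all_moments_measurable _ _ _ P).
  by apply: all_momentsD; do ?apply: all_momentsZ; exact: all_momentsM.
- by apply: filterS (noise_linear hB t f h) => w ->; ring.
Qed.

Lemma chaos_coef_noise h b :
  chaos_coef B m (B h) b = \sum_(k <- finsupp b) ip h (m k) * (munit k == b)%:R.
Proof.
have [orth _] := hm.
pose f := h + \sum_(k <- finsupp b) (- ip h (m k)) *: m k.
have split_coef (s : seq nat) :
    chaos_coef B m (B (h + \sum_(k <- s) (- ip h (m k)) *: m k)) b =
    chaos_coef B m (B h) b - \sum_(k <- s) ip h (m k) * (munit k == b)%:R.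
  elim: s => [|k s IH]; first by rewrite !big_nil addr0 subr0.
  rewrite !big_cons addrCA addrC chaos_coef_noise_linear IH.
  rewrite -(xi_orthonormal (munit k) b) [X in _ + _ * X]chaos_coefE.
  under [X in _ + _ * X = _]eq_Rintegral do rewrite -xi_munit.
  by ring.
apply/eqP; rewrite -subr_eq0 -split_coef -/f chaos_coefE.
under eq_Rintegral do rewrite (xiE b (finsupp b))//.
have fm k : k \in finsupp b -> ip f (m k) = 0.
  move=> kb; rewrite /f ipDl linear_sumlz (big_fsetD1 k)//= ipZl orth eqxx mulr1.
  rewrite big1_fset ?addr0 ?subrr// => j; rewrite !inE => /andP[jk _] _.
  by rewrite ipZl orth (negbTE jk) mulr0.
(* Taking [g = 0] and exponent 0 in [stein] leaves E[B(f) xi_b] on the left and a zero factor on the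
   right. *)
have [_ /(_ 0 0%N)] := stein_prod hB f _ _ (fun k => hermite_normal (b k)) fm.
under eq_Rintegral do rewrite expr0 mulr1.
by move=> ->; rewrite !mul0r.
Qed.

End chaos_orthonormality.

(** * Formal expansions *)

(** Polarization writes [ip] through the norm, hence it passes to the limit; along the partial sums
    its value is [c k] as soon as n > k. *)
Lemma ip_basis_series (R : realType) (H : completeNormedModType R)
    (ip : {dot H for (@idfun R)}) (m : nat -> H) (c : nat -> R) (v : H) :
  norm_of_dot ip -> orthonormal_basis ip m ->
  series (fun k => c k *: m k) @ \oo --> v -> forall k, ip v (m k) = c k.
Proof.
move=> hip [orth _] cv k; pose S := series (fun k => c k *: m k).
have polar u w : ip u w = 2^-1 * (`|u + w| ^+ 2 - `|u| ^+ 2 - `|w| ^+ 2).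
  by rewrite !hip !ipDl !ipDr (ipC w u); field.
have sq_cvg (u_ : nat -> H) u : u_ @ \oo --> u ->
    `|u_ n| ^+ 2 @[n --> \oo] --> `|u| ^+ 2.
  move=> /cvg_norm cu; under eq_fun do rewrite expr2.
  by rewrite expr2; exact: cvgM.
have lim_v : ip (S n) (m k) @[n --> \oo] --> ip v (m k).
  rewrite polar; under eq_fun do rewrite polar.
  apply: cvgM; first exact: cvg_cst.
  apply: cvgB; last exact: cvg_cst.
  apply: cvgB; last exact: sq_cvg.
  by apply: sq_cvg; apply: cvgD => //; exact: cvg_cst.
have lim_c : ip (S n) (m k) @[n --> \oo] --> c k.
  apply: cvg_near_cst; near=> n; rewrite /S /series/= linear_sumlz.
  rewrite (bigD1_seq k) ?iota_uniq//=; last first.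
    by rewrite mem_index_iota/=; near: n; exact: nbhs_infty_gt.
  rewrite ipZl orth eqxx mulr1 big1 ?addr0// => j jk.
  by rewrite ipZl orth (negbTE jk) mulr0.
exact: cvg_unique lim_v lim_c.
Unshelve. all: by end_near. Qed.

(** * Wick product of a first-order series with one basis element *)

Section wick_by_basis_element.
Context {R : realType}.
Variables (c : fseries R) (a : mindex).
Hypothesis c_munit : forall b, (forall k, b <> munit k) -> c b = 0.
Let delta : fseries R := fun b => (a == b)%:R.

Lemma wick_delta_neq0 g : wick c delta g != 0 ->
  exists2 k, k \in finsupp g & a = msub g (munit k).
Proof.
apply: contra_neqP => Ng; apply: fsbig1 => -[b b'] /= bb'; rewrite /delta.
have [ab'|_] := eqVneq a b'; last by rewrite mulr0 mul0r.
rewrite c_munit ?mul0r// => k bk; apply: Ng; exists k.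
  by rewrite -bb' bk mem_madd_munit.
by rewrite -bb' bk madd_munitK.
Qed.

(** Only the pair of [munit k] and [a] survives, and its ratio of factorials is a_k + 1. *)
Lemma wick_delta_madd k :
  wick c delta (madd (munit k) a) = c (munit k) * Num.sqrt (a k).+1%:R.
Proof.
rewrite /wick (fsbigE [:: (munit k, a)])//=.
- rewrite big_cons big_nil ifT ?inE//= addr0 /delta eqxx mulr1.
  rewrite mfact_munit mfact_madd_munit.
  congr (_ * Num.sqrt _); rewrite natrM mul1r mulfK//.
  by rewrite pnatr_eq0 -lt0n mfact_gt0.
- by move=> p /=; rewrite inE => /eqP ->.
- move=> [b b'] /= bb'; rewrite inE /delta => neq.
  have [ab'|_] := eqVneq a b'; last by rewrite mulr0 mul0r.
  subst b'; case/eqP: neq; congr pair; apply/fsfunP => j.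
  by have /fsfunP/(_ j) := bb'; rewrite !maddE => /addIn.
Qed.

End wick_by_basis_element.

Theorem theorem4p2 (R : realType) (d : measure_display) (T : measurableType d)
    (P : probability T R) (H : completeNormedModType R)
    (ip : {dot H for (@idfun R)}) (hip : norm_of_dot ip)
    (hsep : separable_space H)
    (m : nat -> H) (hm : orthonormal_basis ip m)
    (B : H -> {RV P >-> R}) (hB : white_noise ip B)
    (eta : T -> H) (heta_meas : noise_measurable B eta)
    (heta_L2 : (\int[P]_w (`|eta w| ^+ 2)%:E < +oo)%E)
    (eta_ : mindex -> H)
    (heta_E : forall a : mindex, eta_ a = hchaos_coef B m eta a)
    (heta_chaos : has_chaos_series B m eta eta_)
    (etak : mindex -> nat -> R)
    (hetak : forall a : mindex,
       series (fun k => etak a k *: m k) @ \oo --> eta_ a) :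
  is_ito_skorokhod B m eta
    (fun a : mindex => \sum_(k \in [set: nat])
       Num.sqrt (a k)%:R * etak (msub a (munit k)) k).
Proof.
pose c a : fseries R := chaos_coef B m (B (eta_ a)).
have c_munit a k : c a (munit k) = etak a k.
  rewrite /c (chaos_coef_noise hB hm) finsupp_munit big_seq_fset1 eqxx mulr1.
  exact: ip_basis_series hip hm (hetak a) k.
have c0 a b : (forall k, b <> munit k) -> c a b = 0.
  move=> nb; rewrite /c (chaos_coef_noise hB hm) big1// => k _.
  by case: eqP => [kb|]; [case: (nb k)|rewrite mulr0].
pose F a : fseries R := wick (c a) (fun b => (a == b)%:R).
(* Here a = g - epsilon_k, so the factor a_k + 1 becomes g_k; membership in the support guarantees
   g_k > 0. *)
have F_shift g k : k \in finsupp g ->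
    F (msub g (munit k)) g = Num.sqrt (g k)%:R * etak (msub g (munit k)) k.
  move=> kg; rewrite /F -[X in wick _ _ X](msub_munitK _ _ kg) wick_delta_madd.
  rewrite c_munit mulrC msubE munitE eqxx subn1 prednK// lt0n.
  by rewrite -mem_finsupp.
have F_supp g a : F a g != 0 ->
    exists2 k, k \in finsupp g & a = msub g (munit k).
  exact: wick_delta_neq0 (c0 a) _.
rewrite /is_ito_skorokhod.
rewrite (_ : (fun a => _) = F); last first.
  apply/funext => a; rewrite /F /c heta_E; congr wick.
  by apply/funext => b; rewrite (chaos_coef_xi hB hm).
(* All the [a] that can contribute to xi_g: this finite set gives summability and the reindexing
   below. *)
move=> g; pose A := [fset msub g (munit k) | k in finsupp g]%fset.
have F_out a : a \notin A -> F a g = 0.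
  apply: contraNeq => /F_supp[k kg ->]; apply/imfsetP; by exists k.
split.
  apply: (sub_finite_set _ (finite_fset A)) => a /= /F_supp[k kg ->].
  by apply/imfsetP; exists k.
(* For k outside the support, the truncated [msub g (munit k)] is [g], but the factor sqrt(g_k) = 0
   removes the term. *)
rewrite [RHS](fsbigTE A)// (fsbigTE (finsupp g)) => [|k kg]; last first.
  by rewrite fsfun_dflt// sqrtr0 mul0r.
rewrite big_imfset => /= [|j k jg kg]; last exact: msub_munit_inj.
by rewrite big_seq [RHS]big_seq; apply: eq_bigr => k kg; rewrite F_shift.
Qed.
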